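(* Let $K$ be a field, $R=K[x_1,\ldots,x_n]$ with a term order $<$, $F=(f_1,\ldots,f_m)$ a tuple of non-zero elements of $R$, and $I=\langle F\rangle$. Assume that $F$ is not a Gröbner basis. Let $f$ be a non-zero element of $I$ such that $\mathrm{LM}(f)\notin\langle\mathrm{LM}(F)\rangle$. (a) The signature $S(f)$ is an element of $\mathrm{LSyL}(F)\setminus\mathrm{LSy}(F)$. (b) If $S(f)$ is the minimum element (with respect to $\prec$) of $\mathrm{LSyL}(F)\setminus\mathrm{LSy}(F)$ and $S(f)=\hat S(p)$ for an S-pair $p$ of $F$, then $\mathrm{LM}(f)=\mathrm{LM}(r)$ and $S(f)=S(r)$, where $r$ is the remainder of any division of $\mathrm{Spoly}(p)$ with $F$. (c) In the situation of (b), the difference $\frac{1}{\mathrm{LC}(f)}f-\frac{1}{\mathrm{LC}(r)}r$ is $0$ or an element whose signature is smaller than $S(f)$. In particular, if all terms of $f$ are not in $\langle\mathrm{LM}(F)\rangle$, then $f=cr$ for some $c\in K$.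
   Context: $\mathrm{LM}(f)$ and $\mathrm{LC}(f)$ denote the leading monomial and leading coefficient of a non-zero polynomial $f$. $\mathrm{LM}(F)=(\mathrm{LM}(f_1),\ldots,\mathrm{LM}(f_m))$. $F$ is a Gröbner basis if the initial ideal $\langle \mathrm{LM}(f)\mid f\in I\setminus\{0\}\rangle$ is generated by $\mathrm{LM}(F)$. A division of $f\in R$ with $F$ is an expression $f=\sum_{i=1}^m h_if_i+r$ with $h_i,r\in R$, $\mathrm{LM}(h_if_i)\le\mathrm{LM}(f)$ whenever $h_i\ne0$, and $r=0$ or no term of $r$ lies in $\langle\mathrm{LM}(F)\rangle$; $r$ is called the remainder of the division. $R^m=\bigoplus_{i=1}^m Re_i$ is the free module with basis $e_1,\ldots,e_m$; a monomial in $R^m$ is an element $x^\alpha e_i$. $R^m$ carries the Schreyer order $\prec$ of $F$: $x^\alpha e_i\prec x^\beta e_j$ iff $x^\alpha\mathrm{LM}(f_i)<x^\beta\mathrm{LM}(f_j)$, or $x^\alpha\mathrm{LM}(f_i)=x^\beta\mathrm{LM}(f_j)$ and $i<j$. For a non-zero $u\in R^m$, $\mathrm{LM}(u)$ is the $\prec$-largest monomial occurring in $u$ with non-zero coefficient; for a submodule $M\subset R^m$, $\mathrm{LM}(M)$ is the set of leading monomials of non-zero elements of $M$. For $u\in R^m$, $\bar u\in I$ is its image under the $R$-linear map $e_i\mapsto f_i$. $\mathrm{Syz}(F)$ is the kernel of this map; $\mathrm{Syz}(\mathrm{LM}(F))\subset R^m$ is the kernel of the $R$-linear map $e_i\mapsto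 \mathrm{LM}(f_i)$. Put $\mathrm{LSy}(F)=\mathrm{LM}(\mathrm{Syz}(F))$ and $\mathrm{LSyL}(F)=\mathrm{LM}(\mathrm{Syz}(\mathrm{LM}(F)))$. The signature of a non-zero $f\in I$ is $S(f)=\min_\prec\{\mathrm{LM}(u)\mid u\in R^m,\ \bar u=f\}$. An S-pair of $F$ is a pair of monomials $p=(x^\gamma e_k,x^\delta e_\ell)$ in $R^m$ with $k<\ell$ and $x^\gamma\mathrm{LM}(f_k)=x^\delta\mathrm{LM}(f_\ell)$. Its S-polynomial is $\mathrm{Spoly}(p)=\frac{1}{\mathrm{LC}(f_k)}x^\gamma f_k-\frac{1}{\mathrm{LC}(f_\ell)}x^\delta f_\ell$, and its guessed signature is $\hat S(p)=x^\delta e_\ell$. *)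

(* Defs.v *)
From mathcomp Require Import all_boot all_order all_algebra.
From mathcomp Require Export mpoly.

Set Implicit Arguments.
Unset Strict Implicit.
Unset Printing Implicit Defensive.

Import GRing.Theory.
Local Open Scope ring_scope.

Definition termle (n : nat) (lt : rel 'X_{1..n}) (a b : 'X_{1..n}) : bool :=
  (a == b) || lt a b.

(* [lt] is the strict part of the term order; [0%MM] is the monomial 1 and
   [(a + b)%MM] is the product of the monomials a and b. *)
Definition term_order (n : nat) (lt : rel 'X_{1..n}) : Prop :=
  [/\ irreflexive lt,
      transitive lt,
      forall a b : 'X_{1..n}, a != b -> lt a b || lt b a,
      forall a : 'X_{1..n}, a != 0%MM -> lt 0%MM a
    & forall a b c : 'X_{1..n}, lt a b -> lt (a + c)%MM (b + c)%MM].

(* The library's [mlead] is for one fixed order.  As 0%MM is the least monomial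
   for a term order, starting the maximum from it is harmless when f != 0. *)
Definition LM (n : nat) (K : fieldType) (lt : rel 'X_{1..n})
    (f : {mpoly K[n]}) : 'X_{1..n} :=
  foldr (fun a b => if lt b a then a else b) 0%MM (msupp f).

Definition LC (n : nat) (K : fieldType) (lt : rel 'X_{1..n})
    (f : {mpoly K[n]}) : K := f@_(LM lt f).

Definition ideal_gen (R : comNzRingType) (G : R -> Prop) (f : R) : Prop :=
  exists (k : nat) (h g : 'I_k -> R),
    (forall i, G (g i)) /\ f = \sum_(i < k) h i * g i.

Section Signatures.

Variables (n m : nat) (K : fieldType) (lt : rel 'X_{1..n}).
Variable F : m.-tuple {mpoly K[n]}.

Local Notation R := {mpoly K[n]}.

(* The monomial x^a e_i of R^m is the pair (a, i). *)
Definition modmon : Type := ('X_{1..n} * 'I_m)%type.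

Definition LMtuple : m.-tuple R := [tuple 'X_[LM lt (tnth F i)] | i < m].

Definition idealF : R -> Prop := ideal_gen (fun g => g \in F).

Definition idealLM : R -> Prop := ideal_gen (fun g => g \in LMtuple).

Definition initial_ideal : R -> Prop :=
  ideal_gen (fun g => exists f : R, [/\ idealF f, f != 0 & g = 'X_[LM lt f]]).

Definition groebner : Prop := forall g : R, initial_ideal g <-> idealLM g.

Definition no_term_in_idealLM (f : R) : Prop :=
  forall a : 'X_{1..n}, a \in msupp f -> ~ idealLM (f@_a *: 'X_[a]).

Definition is_division (f : R) (h : 'I_m -> R) (r : R) : Prop :=
  [/\ f = \sum_(i < m) h i * tnth F i + r,
      forall i, h i != 0 -> termle lt (LM lt (h i * tnth F i)) (LM lt f)
    & r = 0 \/ no_term_in_idealLM r].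

Definition schreyer_lt (s t : modmon) : bool :=
  let a := (s.1 + LM lt (tnth F s.2))%MM in
  let b := (t.1 + LM lt (tnth F t.2))%MM in
  lt a b || ((a == b) && (s.2 < t.2)%N).

Definition schreyer_le (s t : modmon) : bool := (s == t) || schreyer_lt s t.

Definition occurs (u : 'rV[R]_m) (s : modmon) : Prop := (u 0 s.2)@_(s.1) != 0.

(* [s = LM(u)]; in particular u is non-zero. *)
Definition is_modLM (u : 'rV[R]_m) (s : modmon) : Prop :=
  occurs u s /\ forall t, occurs u t -> schreyer_le t s.

Definition modLM_set (M : 'rV[R]_m -> Prop) (s : modmon) : Prop :=
  exists2 u : 'rV[R]_m, M u & is_modLM u s.

Definition lincomb (G : m.-tuple R) (u : 'rV[R]_m) : R :=
  \sum_(i < m) u 0 i * tnth G i.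

Definition syz (G : m.-tuple R) (u : 'rV[R]_m) : Prop := lincomb G u = 0.

Definition LSy : modmon -> Prop := modLM_set (syz F).

Definition LSyL : modmon -> Prop := modLM_set (syz LMtuple).

Definition is_min (A : modmon -> Prop) (s : modmon) : Prop :=
  A s /\ forall t, A t -> schreyer_le s t.

(* [s = S(f)]. *)
Definition is_signature (f : R) (s : modmon) : Prop :=
  is_min (modLM_set (fun u => lincomb F u = f)) s.

Definition is_spair (p : modmon * modmon) : Prop :=
  (p.1.2 < p.2.2)%N /\
  (p.1.1 + LM lt (tnth F p.1.2) = p.2.1 + LM lt (tnth F p.2.2))%MM.

Definition spoly (p : modmon * modmon) : R :=
  (LC lt (tnth F p.1.2))^-1 *: ('X_[p.1.1] * tnth F p.1.2)
  - (LC lt (tnth F p.2.2))^-1 *: ('X_[p.2.1] * tnth F p.2.2).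

Definition guessed_signature (p : modmon * modmon) : modmon := p.2.

End Signatures.

(* Main.v *)
(** The signature s of g is not in LSy(F), since a syzygy with leading monomial s
    could be subtracted from a minimal representation of g to lower it. If LM(g)
    is not in <LM(F)>, then s is in LSyL(F): the terms of a minimal
    representation u whose image under e_i -> LM(f_i) is that of s must cancel in
    g, so they form a syzygy of LM(F) with leading monomial s.

    Hence if s is minimal in LSyL(F) \ LSy(F), any non-zero g represented by
    monomials smaller than s has LM(g) in <LM(F)>. A division of Spoly(p) by F
    yields a representation of r with leading monomial s, so a suitable f - c r
    is represented below s; comparing leading monomials gives (b) and (c). *)

Require Import Defs.
From mathcomp Require Import all_boot all_order all_algebra.
From mathcomp Require Import mpoly.
From Stdlib Require Import Classical.

Set Implicit Arguments.
Unset Strict Implicit.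
Unset Printing Implicit Defensive.

Import GRing.Theory.
Local Open Scope ring_scope.

(** * Least elements of finite lists and Dickson's lemma *)

Lemma seq_least (T : eqType) (le : rel T) (x : T) (s : seq T) :
    total le -> transitive le ->
  exists2 y, y \in x :: s & {in x :: s, forall z, le y z}.
Proof.
move=> tot tr; elim: s x => [|a s IH] x.
  exists x; rewrite ?mem_head // => z; rewrite inE => /eqP->.
  by case/orP: (tot x x).
have [y ys ymin] := IH a.
case/orP: (tot x y) => xy.
- exists x; rewrite ?mem_head // => z; rewrite inE => /predU1P[->|/ymin].
    by case/orP: (tot x x).
  exact: tr.
- exists y; first by rewrite inE ys orbT.
  by move=> z; rewrite inE => /predU1P[->|/ymin].
Qed.

(* Dickson's lemma, with the exponents replaced by a list of nat-valued
   functions so that it also applies to the monomials of a free module. *)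
Lemma dickson (T : eqType) (cs : seq (T -> nat)) (P : T -> Prop) :
  exists2 B : seq T, {in B, forall b, P b} &
    forall p, P p ->
      exists2 b, b \in B & all (fun c : T -> nat => c b <= c p)%N cs.
Proof.
elim: cs P => [|c cs IH] P.
  have [[x Px]|nP] := classic (exists x, P x).
    exists [:: x]; first by move=> b; rewrite inE => /eqP->.
    by move=> p _; exists x; rewrite ?mem_head.
  by exists [::] => // p Pp; case: nP; exists p.
have [B0 B0P B0b] := IH P.
(* The elements with [c p < k] are covered level by level: on each level [c] is constant, so the
   induction hypothesis for [cs] suffices. *)
have low k : exists2 B : seq T, {in B, forall b, P b} &
    forall p, P p -> (c p < k)%N ->
      exists2 b, b \in B & all (fun c : T -> nat => c b <= c p)%N (c :: cs).
  elim: k => [|k [B BP Bb]]; first by exists [::].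
  have [Bk BkP Bkb] := IH (fun p => P p /\ c p = k).
  exists (B ++ Bk) => [b|p Pp].
    by rewrite mem_cat => /orP[/BP //|/BkP[]].
  rewrite ltnS leq_eqVlt => /predU1P[cp|cp].
    have [b bB ball] := Bkb p (conj Pp cp).
    exists b; first by rewrite mem_cat bB orbT.
    by rewrite /= ball andbT cp; have [_ ->] := BkP b bB.
  have [b bB ball] := Bb p Pp cp.
  by exists b => //; rewrite mem_cat bB.
(* At or above this threshold, every [b] in [B0] satisfies [c b <= c p], so [B0] alone covers such
   [p]. *)
have [B BP Bb] := low (\max_(b <- B0) c b).
exists (B0 ++ B) => [b|p Pp].
  by rewrite mem_cat => /orP[/B0P|/BP].
have [lt_cp|le_cp] := ltnP (c p) (\max_(b <- B0) c b).
  have [b bB ball] := Bb p Pp lt_cp.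
  by exists b => //; rewrite mem_cat bB orbT.
have [b bB ball] := B0b p Pp.
exists b; first by rewrite mem_cat bB.
by rewrite /= ball andbT (leq_trans _ le_cp) // (leq_bigmax_seq b).
Qed.

(** * Term orders and leading monomials of products *)

Section TermOrder.

Variables (n : nat) (K : fieldType) (lt : rel 'X_{1..n}).
Hypothesis lt_order : term_order lt.

Local Notation R := {mpoly K[n]}.
Local Notation le := (termle lt).

Lemma lt_irr a : lt a a = false.
Proof. by case: lt_order => + _ _ _ _; apply. Qed.

Lemma lt_trans : transitive lt.
Proof. by case: lt_order. Qed.

Lemma le_refl a : le a a.
Proof. by rewrite /termle eqxx. Qed.

Lemma lt_le_trans b a c : lt a b -> le b c -> lt a c.
Proof. by move=> ab /predU1P[<- //|]; apply: lt_trans. Qed.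

Lemma le_lt_trans b a c : le a b -> lt b c -> lt a c.
Proof. by move=> /predU1P[-> //|]; apply: lt_trans. Qed.

Lemma le_trans : transitive le.
Proof.
move=> b a c /predU1P[-> //|ab] bc.
by rewrite /termle (lt_le_trans ab bc) orbT.
Qed.

Lemma le_anti a b : le a b -> le b a -> a = b.
Proof.
by case/predU1P=> // ab ba; move: (lt_le_trans ab ba); rewrite lt_irr.
Qed.

Lemma le_total : total le.
Proof.
move=> a b; rewrite /termle; have [//|ab] := eqVneq a b.
by case: lt_order => _ _ /(_ a b ab) /orP[->|->] _ _; rewrite ?orbT.
Qed.

Lemma le_neq_lt a b : le a b -> a != b -> lt a b.
Proof. by case/predU1P=> [->|//]; rewrite eqxx. Qed.

Lemma lt_add2r c a b : lt a b -> lt (a + c)%MM (b + c)%MM.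
Proof. by case: lt_order => _ _ _ _; apply. Qed.

Lemma le_add2r c a b : le a b -> le (a + c)%MM (b + c)%MM.
Proof.
by case/predU1P=> [->|/(lt_add2r c) ab]; [exact: le_refl | rewrite /termle ab orbT].
Qed.

Lemma le_add2l c a b : le a b -> le (c + a)%MM (c + b)%MM.
Proof. by rewrite ![(c + _)%MM]addmC; apply: le_add2r. Qed.

Lemma dvdm_le a b : (a <= b)%MM -> le a b.
Proof.
move/submK <-; set d := (b - a)%MM; rewrite addmC.
have [->|d0] := eqVneq d 0%MM; first by rewrite addm0 le_refl.
case: lt_order => _ _ _ /(_ d d0) /(lt_add2r a) + _.
by rewrite add0m addmC /termle => ->; rewrite orbT.
Qed.

Lemma LM_msupp (f : R) : f != 0 -> LM lt f \in msupp f.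
Proof.
rewrite -msupp_eq0 /LM; elim: (msupp f) => //= a s IH _; case: ifP => [|nlt].
  by rewrite mem_head.
case: s IH nlt => [_ /= nlt|b s /(_ isT) IH _]; last by rewrite inE IH orbT.
(* On a one-element support the fold may return its start value [0%MM]; since [0%MM] is least, this
   happens only if [a] is [0%MM] itself. *)
rewrite inE eq_sym; apply/eqP; apply: contraFeq nlt => a0.
by case: lt_order => _ _ _ /(_ a a0).
Qed.

Lemma msupp_le_LM (f : R) a : a \in msupp f -> le a (LM lt f).
Proof.
rewrite /LM; elim: (msupp f) => //= b s IH; rewrite inE.
set t := foldr _ _ _ in IH *; case: ifP => bt.
  case/predU1P=> [->|/IH at_]; first exact: le_refl.
  by apply: le_trans at_ _; rewrite /termle bt orbT.
case/predU1P=> [->|/IH //].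
by case/orP: (le_total b t) => // /predU1P[->|]; rewrite ?le_refl ?bt.
Qed.

Lemma LM_eq (f : R) a :
  a \in msupp f -> {in msupp f, forall b, le b a} -> LM lt f = a.
Proof.
move=> af fa; apply: le_anti (msupp_le_LM af); apply/fa/LM_msupp.
by apply: contraTneq af => ->; rewrite msupp0.
Qed.

Lemma LC_neq0 (f : R) : f != 0 -> LC lt f != 0.
Proof. by move/LM_msupp; rewrite mcoeff_msupp. Qed.

Lemma msuppM_bound (p q : R) b :
    {in msupp p, forall a, le (a + LM lt q)%MM b} ->
  {in msupp (p * q), forall c, le c b}.
Proof.
move=> pb c /msuppM_le /allpairsP[[a d] /= [ap dq ->]].
exact: le_trans (le_add2l _ (msupp_le_LM dq)) (pb _ ap).
Qed.

(** A term of [p] reaches [b] only through the leading term of [q]: any smaller term of [q] gives a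
    product strictly below [b]. *)
Lemma mcoeffM_bound (p q : R) b :
    {in msupp p, forall a, le (a + LM lt q)%MM b} ->
  (p * q)@_b = \sum_(a <- msupp p | (a + LM lt q)%MM == b) p@_a * LC lt q.
Proof.
move=> pb; rewrite {1}(mpolyE p) mulr_suml raddf_sum /= [RHS]big_mkcond /=.
apply: eq_big_seq => a ap; rewrite -scalerAl mcoeffZ.
case: eqP => [<-|/eqP neq]; first by rewrite ['X_[_] * q]mulrC mcoeffMX.
rewrite (@memN_msupp_eq0 _ _ (_ * _)) ?mulr0 //.
have Xb : {in msupp ('X_[a] : R), forall c, le (c + LM lt q)%MM (a + LM lt q)%MM}.
  by move=> c; rewrite msuppX inE => /eqP->; exact: le_refl.
apply: contra neq => bX; apply/eqP.
by apply: (le_anti (pb _ ap)); apply: (msuppM_bound Xb).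
Qed.

(** The coefficient of [p * q] at the product of the leading monomials is [LC p * LC q], non-zero in
    a field. This converts the degree condition of a division into a bound on every term of a
    quotient. *)
Lemma msupp_add_LM (p q : R) a :
  p != 0 -> q != 0 -> a \in msupp p -> le (a + LM lt q)%MM (LM lt (p * q)).
Proof.
move=> p0 q0 /msupp_le_LM ap; apply: le_trans (le_add2r _ ap) _.
apply: msupp_le_LM; rewrite mcoeff_msupp mcoeffM_bound; last first.
  by move=> c /msupp_le_LM; apply: le_add2r.
under eq_bigl => c do rewrite (can_eq (addmK _)).
rewrite -big_filter filter_pred1_uniq ?msupp_uniq ?LM_msupp // big_seq1.
by rewrite mulf_neq0 ?LC_neq0.
Qed.

(* v collects the terms of p whose product with LM q is b, scaled by LC q. *)
Lemma top_part (p q : R) b :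
    q != 0 -> {in msupp p, forall a, le (a + LM lt q)%MM b} ->
  exists2 v : R, v * 'X_[LM lt q] = (p * q)@_b *: 'X_[b] &
    forall c, (v@_c != 0) = (p@_c != 0) && ((c + LM lt q)%MM == b).
Proof.
move=> q0 pb; rewrite (mcoeffM_bound pb).
have [/hasP[a ap /eqP ab]|/hasPn nb] :=
    boolP (has (fun a => (a + LM lt q)%MM == b) (msupp p)).
  exists ((p@_a * LC lt q) *: 'X_[a]).
    rewrite -scalerAl -mpolyXD ab -ab.
    under eq_bigl => c do rewrite (can_eq (addmK _)).
    by rewrite -big_filter filter_pred1_uniq ?msupp_uniq // big_seq1.
  move=> c; rewrite mcoeffZ mcoeffX -ab (can_eq (addmK _)) [a == c]eq_sym.
  have [->|_] := eqVneq c a; last by rewrite mulr0 andbF eqxx.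
  by rewrite mulr1 mulf_eq0 (negPf (LC_neq0 q0)) orbF andbT.
exists 0; first by rewrite mul0r big_seq_cond big_pred0 ?scale0r // => a;
  apply/negP=> /andP[/nb/negP].
move=> c; rewrite mcoeff0 eqxx; apply/esym/negP=> /andP[pc].
by apply/negP/nb; rewrite mcoeff_msupp.
Qed.

End TermOrder.

(** * The Schreyer order and its minima *)

Section Signature.

Variables (n m : nat) (K : fieldType) (lt : rel 'X_{1..n}).
Variable F : m.-tuple {mpoly K[n]}.
Hypothesis lt_order : term_order lt.
Hypothesis F_neq0 : forall i : 'I_m, tnth F i != 0.

Local Notation R := {mpoly K[n]}.
Local Notation mon := ('X_{1..n} * 'I_m)%type.
Local Notation le := (termle lt).
Local Notation slt := (schreyer_lt lt F).
Local Notation sle := (schreyer_le lt F).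
Local Notation LMF i := (LM lt (tnth F i)).
Local Notation image s := (s.1 + LMF s.2)%MM.

Lemma slt_irr s : slt s s = false.
Proof. by rewrite /schreyer_lt lt_irr // ltnn andbF. Qed.

Lemma slt_trans : transitive slt.
Proof.
move=> t s r; rewrite /schreyer_lt.
case/orP=> [st|/andP[/eqP-> st]]; case/orP=> [tr|/andP[/eqP<- tr]].
- by rewrite (lt_trans lt_order st tr).
- by rewrite st.
- by rewrite tr.
- by rewrite eqxx (ltn_trans st tr) orbT.
Qed.

Lemma sle_trans : transitive sle.
Proof.
move=> t s r /predU1P[-> //|st] /predU1P[<-|tr]; rewrite /schreyer_le ?st ?orbT //.
by rewrite (slt_trans st tr) orbT.
Qed.

Lemma sle_lt_trans t s r : sle s t -> slt t r -> slt s r.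
Proof. by case/predU1P=> [->|] //; apply: slt_trans. Qed.

Lemma slt_geF s t : slt s t -> sle t s = false.
Proof.
by move=> st; apply/negP=> ts; move: (sle_lt_trans ts st); rewrite slt_irr.
Qed.

Lemma sle_anti s t : sle s t -> sle t s -> s = t.
Proof. by case/predU1P=> // /slt_geF->. Qed.

Lemma sle_total : total sle.
Proof.
move=> [a i] [b j]; rewrite /schreyer_le /schreyer_lt /=.
have [eq_im|ne_im] := eqVneq (a + LMF i)%MM (b + LMF j)%MM; last first.
  case: lt_order => _ _ tot _ _.
  by case/orP: (tot _ _ ne_im) => ->; rewrite !orbT.
case: (ltngtP i j) => [||/val_inj eq_ij]; rewrite ?eq_im ?eqxx ?orbT //.
by move: eq_im; rewrite eq_ij => /addIm->; rewrite eqxx.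
Qed.

Lemma sle_image s t : sle s t -> le (image s) (image t).
Proof.
case/predU1P=> [->|]; first exact: le_refl.
by case/orP=> [st|/andP[/eqP-> _]]; [rewrite /termle st orbT | exact: le_refl].
Qed.

(** By Dickson's lemma, finitely many elements of [A] divide all the others within their component.
    Divisibility implies [sle], so the least of these finitely many is the minimum of [A]. *)
Lemma schreyer_min (A : mon -> Prop) s : A s -> exists t, is_min lt F A t.
Proof.
move=> As.
(* The coordinates [s.2] and [m - s.2] together force equal components; the remaining ones compare
   exponents. *)
pose cs : seq (mon -> nat) := [:: fun s : mon => s.2 : nat; fun s : mon => (m - s.2)%N]
  ++ [seq (fun s : mon => s.1 i) | i <- enum 'I_n].
have [B BA Bmin] := dickson cs A.
case: B BA Bmin => [|b B] BA Bmin; first by have [] := Bmin s As.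
have [t tB tmin] := seq_least b B sle_total sle_trans.
exists t; split=> [|p Ap]; first exact: BA.
have [c cB] := Bmin p Ap; rewrite all_cat all_map /= => /andP[/and3P[le2 ge2 _]].
move/allP=> le1; apply: sle_trans (tmin c cB) _.
case: c p le1 le2 ge2 {cB Ap} => [c i] [p j] /= le1 le2 ge2.
have eq_ij : i = j.
  by apply/val_inj/anti_leq; rewrite le2 -(leq_sub2lE _ (ltnW (ltn_ord j))) ge2.
move: eq_ij {le2 ge2} => <-; rewrite /schreyer_le /schreyer_lt /= ltnn andbF orbF.
rewrite xpair_eqE eqxx andbT -(eqm_add2r (LMF i)).
apply: (le_add2r lt_order); apply: (dvdm_le lt_order).
by apply/mnm_lepP => k; apply: le1; rewrite mem_enum.
Qed.

(** * Leading monomials and images of elements of the free module *)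

Lemma modLM_exists (u : 'rV[R]_m) : u != 0 -> exists s, is_modLM lt F u s.
Proof.
case/rV0Pn=> i; rewrite -msupp_eq0; case supp_i: (msupp _) => [//|a l] _.
(* [S] lists the monomials occurring in [u]; the leading one is its least element for the reversed
   order. *)
pose S : seq mon := flatten [seq [seq (b, j) | b <- msupp (u 0 j)] | j <- enum 'I_m].
have inS (s : mon) : s \in S = ((u 0 s.2)@_(s.1) != 0).
  rewrite -mcoeff_msupp; apply/flatten_mapP/idP => [[j _ /mapP[b bu ->]] //|su].
  by exists s.2; [rewrite mem_enum | apply/mapP; exists s.1 => //; case: (s)].
have: (a, i) \in S by rewrite inS -mcoeff_msupp supp_i mem_head.
case: S inS => // x S inS _.
have [||t tS tmax] := @seq_least _ (fun s t => sle t s) x S.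
- by move=> s t; apply: sle_total.
- by move=> s t r ts sr; apply: sle_trans sr ts.
by exists t; split=> [|r]; rewrite /occurs -inS //; apply: tmax.
Qed.

Lemma lincombB (u v : 'rV[R]_m) (c : K) :
  lincomb F (u - c%:MP *: v) = lincomb F u - c *: lincomb F v.
Proof.
rewrite /lincomb scaler_sumr -sumrB; apply: eq_bigr => i _.
by rewrite !mxE mulrBl mul_mpolyC scalerAl.
Qed.

Lemma lincombZ (u : 'rV[R]_m) (c : K) :
  lincomb F (c%:MP *: u) = c *: lincomb F u.
Proof.
rewrite /lincomb scaler_sumr; apply: eq_bigr => i _.
by rewrite !mxE mul_mpolyC scalerAl.
Qed.

Lemma idealF_lincomb f : idealF F f -> exists u, lincomb F u = f.
Proof.
case=> k [h [g [gF ->]]].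
elim: k h g gF => [|k IH] h g gF.
  exists 0; rewrite big_ord0 /lincomb big1 // => i _; by rewrite mxE mul0r.
have [u uE] := IH (fun i => h (widen_ord (leqnSn k) i))
  (fun i => g (widen_ord (leqnSn k) i)) (fun i => gF _).
have /tnthP[j gE] := gF ord_max.
(* Generators may repeat, so the new coefficient is added to what slot [j] already holds. *)
exists (\row_i (u 0 i + (if i == j then h ord_max else 0))).
rewrite big_ord_recr /= -uE gE /lincomb.
under eq_bigr => i _ do rewrite mxE mulrDl.
rewrite big_split /=; congr (_ + _).
by rewrite (bigD1 j) //= eqxx big1 ?addr0 // => i /negPf->; rewrite mul0r.
Qed.

Lemma idealLM_image (s : mon) : idealLM lt F 'X_[image s].
Proof.
exists 1, (fun=> 'X_[s.1]), (fun=> 'X_[LMF s.2]); split=> [_|].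
  by apply/tnthP; exists s.2; rewrite tnth_mktuple.
by rewrite big_ord1 mpolyXD.
Qed.

Lemma idealLM_scale (c : K) (g : R) : idealLM lt F g -> idealLM lt F (c *: g).
Proof.
case=> k [h [p [pL ->]]]; exists k, (fun i => c *: h i), p; split=> //.
by rewrite scaler_sumr; apply: eq_bigr => i _; rewrite scalerAl.
Qed.

Lemma no_term_msupp (g : R) a :
  no_term_in_idealLM lt F g -> a \in msupp g -> ~ idealLM lt F 'X_[a].
Proof. by move=> ng ag /(idealLM_scale g@_a); apply: ng. Qed.

Lemma modLM_bound (u : 'rV[R]_m) s :
  is_modLM lt F u s ->
  forall i, {in msupp (u 0 i), forall a, le (a + LMF i)%MM (image s)}.
Proof.
case=> _ us i a; rewrite mcoeff_msupp => ua.
exact: (sle_image (us (a, i) ua)).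
Qed.

Lemma msupp_lincomb (u : 'rV[R]_m) b :
    (forall i, {in msupp (u 0 i), forall a, le (a + LMF i)%MM b}) ->
  {in msupp (lincomb F u), forall c, le c b}.
Proof.
move=> ub c /msupp_sum_le /flatten_mapP[i _].
exact: (msuppM_bound lt_order (ub i)).
Qed.

(** * Signatures and syzygies *)

Definition LSyL_not_LSy (s : mon) : Prop := LSyL lt F s /\ ~ LSy lt F s.

(** With [c] the ratio of the coefficients at [s], the monomial [s] cancels; every other monomial of
    the difference occurs in [u] or [v], hence lies below [s]. *)
Lemma cancel_modLM (u v : 'rV[R]_m) s :
    is_modLM lt F u s -> is_modLM lt F v s ->
  exists2 c : K, c != 0 & forall t, occurs (u - c%:MP *: v) t -> slt t s.
Proof.
move=> [us umax] [vs vmax].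
exists ((u 0 s.2)@_(s.1) / (v 0 s.2)@_(s.1)).
  by rewrite mulf_neq0 ?invr_neq0.
move=> t; rewrite /occurs !mxE mcoeffB mcoeffCM => ot.
have ts : sle t s.
  have [ut|] := boolP ((u 0 t.2)@_(t.1) != 0); first exact: umax.
  rewrite negbK => /eqP u0; apply: vmax; apply: contraNneq ot => v0.
  by rewrite u0 v0 mulr0 subr0.
case/predU1P: ts ot => // ->.
by rewrite mulfVK // subrr eqxx.
Qed.

Lemma lincomb_neq0 (u : 'rV[R]_m) : lincomb F u != 0 -> u != 0.
Proof.
apply: contraNneq => ->; rewrite /lincomb big1 // => i _.
by rewrite mxE mul0r.
Qed.

Lemma signature_below (u : 'rV[R]_m) s :
    lincomb F u != 0 -> (forall t, occurs u t -> slt t s) ->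
  exists2 t, is_signature lt F (lincomb F u) t & slt t s.
Proof.
move=> g0 us; have [t ut] := modLM_exists (lincomb_neq0 g0).
have At : modLM_set lt F (fun w => lincomb F w = lincomb F u) t by exists u.
have [r rsig] := schreyer_min At.
exists r => //; apply: sle_lt_trans (us t ut.1).
exact: (rsig.2 t At).
Qed.

Lemma signature_exists (u : 'rV[R]_m) :
  lincomb F u != 0 -> exists s, is_signature lt F (lincomb F u) s.
Proof.
move=> g0; have [t ut] := modLM_exists (lincomb_neq0 g0).
by apply: (@schreyer_min _ t); exists u.
Qed.

Lemma signature_not_LSy (g : R) s :
  g != 0 -> ~ idealLM lt F 'X_[LM lt g] -> is_signature lt F g s -> LSyL_not_LSy s.
Proof.
move=> g0 ng [[u ug us] smin]; split; last first.
  (* Subtracting a multiple of the syzygy keeps the image [g] but leaves only monomials below [s],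
     against the minimality of [s]. *)
  case=> v vsyz vs; have [c c0 cancel] := cancel_modLM us vs.
  have gE : lincomb F (u - c%:MP *: v) = g.
    by rewrite lincombB ug vsyz scaler0 subr0.
  have [|t [tA _] ts] := signature_below _ cancel; first by rewrite gE.
  by move: tA; rewrite gE => /smin; rewrite slt_geF.
have ub := modLM_bound us.
(* Every monomial of [g] is at most [image s]; if [image s] occurred it would be the leading
   monomial, which is not in the ideal of leading monomials. *)
have gb : g@_(image s) = 0.
  apply/eqP/negPn/negP; rewrite -mcoeff_msupp => sg; apply: ng.
  rewrite (LM_eq lt_order sg); first exact: idealLM_image.
  by rewrite -ug; apply: msupp_lincomb.
pose top i (w : R) := w * 'X_[LMF i] = (u 0 i * tnth F i)@_(image s) *: 'X_[image s]
  /\ forall c, (w@_c != 0) = ((u 0 i)@_c != 0) && ((c + LMF i)%MM == image s).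
have /fin_all_exists[v vtop] : forall i, exists w, top i w.
  by move=> i; have [w] := top_part lt_order (F_neq0 i) (ub i); exists w.
(* The row keeps the monomials of [u] whose image is that of [s]. Its image under [LMtuple] is the
   term of [g] at [image s], which vanishes. *)
exists (\row_i v i).
  rewrite /syz /lincomb.
  under eq_bigr => i _ do rewrite mxE tnth_mktuple (vtop i).1.
  by rewrite -scaler_suml -raddf_sum /= -/(lincomb F u) ug gb scale0r.
split; first by rewrite /occurs mxE (vtop _).2 us.1 eqxx.
move=> t; rewrite /occurs mxE (vtop _).2 => /andP[ut _].
exact: us.2.
Qed.

(** Otherwise the signature of the image would belong to [LSyL_not_LSy] and lie below its
    minimum. *)
Lemma idealLM_below (u : 'rV[R]_m) s :
    is_min lt F LSyL_not_LSy s -> lincomb F u != 0 ->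
    (forall t, occurs u t -> slt t s) ->
  idealLM lt F 'X_[LM lt (lincomb F u)].
Proof.
move=> [_ smin] g0 us; apply: NNPP => ng.
have [t tsig ts] := signature_below g0 us.
by have /smin := signature_not_LSy g0 ng tsig; rewrite slt_geF.
Qed.

(** * S-pairs and remainders *)

Section SPair.

Variable p : mon * mon.
Hypothesis p_spair : is_spair lt F p.

(** The obvious representation of the S-polynomial minus the vector of quotients; for a division it
    maps to the remainder, for zero [h] to the S-polynomial. The boolean multiplicities select the
    two slots of the pair. *)
Definition spair_row (h : 'I_m -> R) : 'rV[R]_m :=
  \row_j (((LC lt (tnth F p.1.2))^-1 *: 'X_[p.1.1]) *+ (j == p.1.2)
        - ((LC lt (tnth F p.2.2))^-1 *: 'X_[p.2.1]) *+ (j == p.2.2) - h j).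

Lemma lincomb_spair_row h :
  lincomb F (spair_row h) = spoly lt F p - \sum_(i < m) h i * tnth F i.
Proof.
rewrite /lincomb; under eq_bigr => i _ do rewrite mxE !mulrBl !mulrnAl.
rewrite !sumrB /spoly; do 2 congr (_ - _).
  rewrite (bigD1 p.1.2) //= eqxx big1 ?addr0 ?scalerAl // => i /negPf->.
  by rewrite mulr0n.
rewrite (bigD1 p.2.2) //= eqxx big1 ?addr0 ?scalerAl // => i /negPf->.
by rewrite mulr0n.
Qed.

(** Both monomials of the pair have the same image, so the larger index makes [p.2] the larger one;
    the terms of [h] have strictly smaller image and cannot cancel it. *)
Lemma modLM_spair_row h :
    (forall i, {in msupp (h i), forall a, lt (a + LMF i)%MM (image p.2)}) ->
  is_modLM lt F (spair_row h) p.2.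
Proof.
case: p_spair => lt_kl eq_im hlt; split.
  rewrite /occurs mxE !mcoeffB !mcoeffMn eqxx.
  rewrite (gtn_eqF lt_kl : (p.2.2 == p.1.2) = false) mulr0n sub0r.
  rewrite (@memN_msupp_eq0 _ _ (h _)) ?subr0; last first.
    by apply/negP=> /hlt; rewrite lt_irr.
  by rewrite mcoeffZ mcoeffX eqxx mulr1 oppr_eq0 invr_eq0 LC_neq0.
move=> [a j]; rewrite /occurs mxE /= => oa.
have [/hlt ha|nh] := boolP (a \in msupp (h j)).
  by rewrite /schreyer_le /schreyer_lt /= ha orbT.
move: oa; rewrite !mcoeffB !mcoeffMn !mcoeffZ !mcoeffX (memN_msupp_eq0 nh) subr0.
have [-> _|ne2] := eqVneq (a, j) p.2; first by rewrite /schreyer_le eqxx.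
have [<- _|ne1] := eqVneq p.1 (a, j).
  by rewrite /schreyer_le /schreyer_lt eq_im eqxx lt_kl !orbT.
have off (q : mon) (c : K) : (a, j) != q -> c * (q.1 == a)%:R *+ (j == q.2) = 0.
  case: q => b i; rewrite xpair_eqE negb_and eq_sym /=.
  by case/orP=> /negPf->; rewrite ?mulr0 ?mul0rn ?mulr0n.
by rewrite !off ?subrr ?eqxx // eq_sym.
Qed.

Lemma LM_spoly_lt : spoly lt F p != 0 -> lt (LM lt (spoly lt F p)) (image p.2).
Proof.
move=> S0; have [lt_kl eq_im] := p_spair.
have SE : lincomb F (spair_row (fun=> 0)) = spoly lt F p.
  by rewrite lincomb_spair_row big1 ?subr0 // => i _; rewrite mul0r.
have row0 : is_modLM lt F (spair_row (fun=> 0)) p.2.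
  by apply: modLM_spair_row => i a; rewrite msupp0.
apply: le_neq_lt.
  have := msupp_lincomb (modLM_bound row0); rewrite SE.
  by apply; apply: LM_msupp.
apply: contraTneq (LM_msupp lt_order S0) => ->.
(* At the common image both scaled multiples have coefficient 1, so their difference has none. *)
rewrite mcoeff_msupp negbK /spoly mcoeffB !mcoeffZ -{1}eq_im.
rewrite ![_ * tnth _ _]mulrC !mcoeffMX !mulVf ?subrr //; exact: LC_neq0.
Qed.

(** Division keeps all quotient terms below the common image, so [p.2] stays leading. A zero
    remainder would then put [p.2] in [LSy]. *)
Lemma modLM_division h r :
    ~ LSy lt F p.2 -> is_division lt F (spoly lt F p) h r ->
  [/\ lincomb F (spair_row h) = r, is_modLM lt F (spair_row h) p.2 & r != 0].
Proof.
move=> nLSy [SE hle _].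
have rE : lincomb F (spair_row h) = r.
  by rewrite lincomb_spair_row [X in X - _]SE addrC addKr.
(* If the S-polynomial were zero, its row with zero quotients would be a syzygy led by [p.2]. *)
have S0 : spoly lt F p != 0.
  apply: contra_notN nLSy => /eqP S0; exists (spair_row (fun=> 0)).
    by rewrite /syz lincomb_spair_row S0 big1 ?subr0 // => i _; rewrite mul0r.
  by apply: modLM_spair_row => i a; rewrite msupp0.
have rowh : is_modLM lt F (spair_row h) p.2.
  apply: modLM_spair_row => i a ah.
  have h0 : h i != 0 by apply: contraTneq ah => ->; rewrite msupp0.
  apply: (le_lt_trans lt_order) (LM_spoly_lt S0).
  exact: (le_trans lt_order) (msupp_add_LM lt_order h0 (F_neq0 i) ah) (hle i h0).
split=> //; apply: contra_notN nLSy => /eqP r0.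
by exists (spair_row h); rewrite // /syz rE.
Qed.

End SPair.

End Signature.

(** * Comparison of [f] with the remainder *)

Theorem theorem4p1 (n m : nat) (K : fieldType) (lt : rel 'X_{1..n})
    (F : m.-tuple {mpoly K[n]}) (f : {mpoly K[n]})
    (lt_order : term_order lt)
    (F_neq0 : forall i : 'I_m, tnth F i != 0)
    (F_not_groebner : ~ groebner lt F)
    (f_neq0 : f != 0)
    (f_in_I : idealF F f)
    (LMf_notin : ~ idealLM lt F 'X_[LM lt f]) :
  exists s : modmon n m, is_signature lt F f s /\
    let LSyL_minus_LSy t := LSyL lt F t /\ ~ LSy lt F t in
    [/\ (* (a) *)
        LSyL_minus_LSy s,
        (* (b) *)
        is_min lt F LSyL_minus_LSy s ->
        forall p : modmon n m * modmon n m,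
          is_spair lt F p -> s = guessed_signature p ->
        forall (h : 'I_m -> {mpoly K[n]}) (r : {mpoly K[n]}),
          is_division lt F (spoly lt F p) h r ->
        [/\ r != 0, LM lt f = LM lt r & is_signature lt F r s]
      & (* (c) *)
        is_min lt F LSyL_minus_LSy s ->
        forall p : modmon n m * modmon n m,
          is_spair lt F p -> s = guessed_signature p ->
        forall (h : 'I_m -> {mpoly K[n]}) (r : {mpoly K[n]}),
          is_division lt F (spoly lt F p) h r ->
        let d := (LC lt f)^-1 *: f - (LC lt r)^-1 *: r in
        (d = 0 \/ exists2 t, is_signature lt F d t & schreyer_lt lt F t s) /\
        (no_term_in_idealLM lt F f -> exists c : K, f = c *: r)].
Proof.
have [u0 u0f] := idealF_lincomb f_in_I.
have [s sig_f] : exists s, is_signature lt F f s.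
  by rewrite -u0f; apply: signature_exists => //; rewrite u0f.
exists s; split=> // LSyL_minus_LSy.
have s_not_LSy : LSyL_minus_LSy s :=
  signature_not_LSy lt_order F_neq0 f_neq0 LMf_notin sig_f.
(* Facts shared by (b) and (c); [c] is chosen to cancel [s] between representations of [f] and
   [r]. *)
have core p h r : is_min lt F LSyL_minus_LSy s -> is_spair lt F p ->
    s = guessed_signature p -> is_division lt F (spoly lt F p) h r ->
  [/\ r != 0, no_term_in_idealLM lt F r, LM lt f = LM lt r, is_signature lt F r s
    & exists c v, [/\ f - c *: r = lincomb F v,
        forall t, occurs v t -> schreyer_lt lt F t s
      & f - c *: r != 0 -> idealLM lt F 'X_[LM lt (f - c *: r)]]].
  move=> smin pS sE div.
  have nLSy : ~ LSy lt F p.2 by rewrite -[p.2]sE; case: s_not_LSy.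
  have [wr ws r0] := modLM_division lt_order F_neq0 pS nLSy div.
  move: ws; rewrite -[p.2]sE => ws.
  have nr : no_term_in_idealLM lt F r.
    by case: div => _ _ [r_eq0|//]; rewrite r_eq0 eqxx in r0.
  have nLMr : ~ idealLM lt F 'X_[LM lt r].
    by apply: no_term_msupp nr _; apply: LM_msupp.
  have [[u uf us] _] := sig_f.
  have [c c0 cancel] := cancel_modLM us ws.
  have vE : lincomb F (u - c%:MP *: spair_row lt F p h) = f - c *: r.
    by rewrite lincombB uf wr.
  have low : f - c *: r != 0 -> idealLM lt F 'X_[LM lt (f - c *: r)].
    by rewrite -vE => g0; apply: idealLM_below smin g0 cancel.
  have g_le b : {in msupp f, forall a, termle lt a b} ->
      {in msupp r, forall a, termle lt a b} ->
      {in msupp (f - c *: r), forall a, termle lt a b}.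
    by move=> fb rb a /msuppB_le; rewrite mem_cat => /orP[/fb|/msuppZ_le/rb].
  have low_LM a : a \in msupp (f - c *: r) ->
      {in msupp f, forall b, termle lt b a} -> {in msupp r, forall b, termle lt b a} ->
      idealLM lt F 'X_[a].
    move=> ag fa ra; rewrite -(LM_eq lt_order ag (g_le a fa ra)); apply: low.
    by apply: contraTneq ag => ->; rewrite msupp0.
  have f_le := @msupp_le_LM _ _ _ lt_order f.
  have r_le := @msupp_le_LM _ _ _ lt_order r.
  have fMsupp := LM_msupp lt_order f_neq0.
  have rMsupp := LM_msupp lt_order r0.
  split=> //; last by exists c, (u - c%:MP *: spair_row lt F p h).
    (* If the leading monomials differed, the larger one would survive as the leading monomial of
       [f - c *: r] and so lie in the ideal of leading monomials, which contains neither. *)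
    apply/eqP/negPn/negP => neq.
    case/orP: (le_total lt_order (LM lt f) (LM lt r)) => le_fr.
      apply: nLMr; apply: low_LM => // [|b /f_le bf]; last exact: le_trans bf le_fr.
      rewrite mcoeff_msupp mcoeffB mcoeffZ memN_msupp_eq0 ?sub0r ?oppr_eq0.
        by rewrite mulf_neq0 // -mcoeff_msupp.
      by apply/negP=> /f_le /(le_anti lt_order le_fr)/eqP; rewrite (negPf neq).
    apply: LMf_notin; apply: low_LM => // [|b /r_le br]; last exact: le_trans br le_fr.
    rewrite mcoeff_msupp mcoeffB mcoeffZ (@memN_msupp_eq0 _ _ r) ?mulr0 ?subr0.
      by rewrite -mcoeff_msupp.
    by apply/negP=> /r_le fr; move: neq; rewrite (le_anti lt_order fr le_fr) eqxx.
  (* The row bounds the signature [t] of [r] above by [s]; since [t] is also in the set minimised by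
     [s], the two agree. *)
  have At : modLM_set lt F (fun w => lincomb F w = r) s.
    by exists (spair_row lt F p h).
  have [t tsig] : exists t, is_signature lt F r t.
    by rewrite -wr; apply: signature_exists => //; rewrite wr.
  have jt := signature_not_LSy lt_order F_neq0 r0 nLMr tsig.
  by rewrite (sle_anti lt_order (smin.2 t jt) (tsig.2 s At)).
split=> // smin p pS sE h r div; first by case: (core p h r).
have [r0 nr LMfr _ [c [v [gE vs low]]]] :=
  core p h r smin pS sE div.
move=> d; pose g := f - c *: r.
(* The common leading monomial must cancel in [g], which identifies [c] as [LC f / LC r] and makes
   [d] a scalar multiple of [g]. *)
have gM : g@_(LM lt f) = 0.
  apply/eqP/negPn/negP; rewrite -mcoeff_msupp => gf.
  have g0 : g != 0 by apply: contraTneq gf => ->; rewrite msupp0.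
  apply: LMf_notin; rewrite -(LM_eq lt_order gf); first exact: low.
  move=> a /msuppB_le; rewrite mem_cat => /orP[|/msuppZ_le]; first exact: msupp_le_LM.
  by rewrite LMfr; apply: msupp_le_LM.
have LCf : LC lt f = c * LC lt r.
  by apply/eqP; rewrite -subr_eq0 /LC -LMfr -mcoeffZ -mcoeffB; apply/eqP.
have LCf0 : LC lt f != 0 := LC_neq0 lt_order f_neq0.
have dE : d = (LC lt f)^-1 *: g.
  have c0 : c != 0 by apply: contraNneq LCf0 => c0; rewrite LCf c0 mul0r.
  by rewrite /d /g scalerBr scalerA LCf invfM mulrC -mulrA mulVf ?mulr1.
split.
  have [-> |d0] := eqVneq d 0; [by left | right].
  have dv : lincomb F ((LC lt f)^-1%:MP *: v) = d by rewrite lincombZ -gE dE.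
  rewrite -dv; apply: signature_below; rewrite ?dv //.
  move=> t; rewrite /occurs mxE mcoeffCM mulf_eq0 negb_or => /andP[_].
  exact: vs.
(* A non-zero [f - c *: r] would have its leading monomial in the ideal of leading monomials, yet
   that monomial occurs in [f] or [r], neither of which has such a term. *)
move=> nf; exists c; apply/eqP; rewrite -subr_eq0; apply/negPn/negP => g0.
have := LM_msupp lt_order g0; move: (low g0); set a := LM _ _ => aL.
move/msuppB_le; rewrite mem_cat => /orP[af|/msuppZ_le ar].
  exact: (no_term_msupp nf af aL).
exact: (no_term_msupp nr ar aL).
Qed.
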